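(* Let $\Bbbk$ be an algebraically closed field of characteristic $0$. The bosonization $H(\mathfrak{gl}(1,1))$ of the enveloping algebra of the Lie superalgebra $\mathfrak{gl}(1,1)$ over $\Bbbk$ is a semiprime ring but not a prime ring.
   Context: $\mathfrak{gl}(1,1)=M_2(\Bbbk)$ is the Lie superalgebra with even part $\mathfrak g_0=\Bbbk x\oplus\Bbbk y$ and odd part $\mathfrak g_1=\Bbbk u\oplus\Bbbk v$, where $x=e_{11}+e_{22}$, $y=e_{11}$, $u=e_{12}$, $v=e_{21}$; $\mathfrak g_0$ is abelian, $[u,v]=x$, $[u,u]=[v,v]=0$, $[x,u]=[x,v]=0$, $[y,u]=u$, $[y,v]=-v$. Its enveloping algebra $U(\mathfrak{gl}(1,1))$ is the associative unital $\Bbbk$-algebra presented by generators $x,y,u,v$ and relations: $x$ is central, $yu-uy=u$, $yv-vy=-v$, $u^2=0$, $v^2=0$, $uv+vu=x$. The bosonization $H(\mathfrak{gl}(1,1))=U(\mathfrak{gl}(1,1))\#\Bbbk C_2$ is, as an algebra, presented by generators $x,y,u,v,t$ with the relations $xy=yx$, $xu=ux$, $xv=vx$, $yu-uy=u$, $yv-vy=-v$, $u^2=0$, $v^2=0$, $uv+vu=x$ together with $t^2=1$, $tx=xt$, $ty=yt$, $tu=-ut$, $tv=-vt$. *)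

(* Defs.v *)
From HB Require Import structures.
From mathcomp Require Import all_boot all_algebra.
From mathcomp Require Import boolp.
From mathcomp Require Import monalg.

Set Implicit Arguments.
Unset Strict Implicit.
Unset Printing Implicit Defensive.

Import GRing.Theory.
Import Quotient.
Local Open Scope ring_scope.
Local Open Scope quotient_scope.

Section Ideals.
Variable R : nzRingType.
Implicit Types (I J : R -> Prop) (a b c : R).

Definition two_sided_ideal I : Prop :=
  [/\ I 0, forall a b, I a -> I b -> I (a - b),
      forall a b, I b -> I (a * b) & forall a b, I a -> I (a * b)].

Definition gen_ideal (S : R -> Prop) a : Prop :=
  forall I, two_sided_ideal I -> (forall s, S s -> I s) -> I a.

Lemma gen_ideal_ideal (S : R -> Prop) : two_sided_ideal (gen_ideal S).
Proof.
split=> [I [] //|a b ha hb I idI sI|a b hb I idI sI|a b ha I idI sI];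
  have [_ IB Il Ir] := idI.
- by apply: IB; [apply: ha|apply: hb].
- by apply: Il; apply: hb.
- by apply: Ir; apply: ha.
Qed.

Lemma gen_ideal_sub (S : R -> Prop) s : S s -> gen_ideal S s.
Proof. by move=> Ss I _; apply. Qed.

Definition ideal_mul I J c : Prop :=
  exists2 s : seq (R * R), (forall p, p \in s -> I p.1 /\ J p.2) &
    c = \sum_(p <- s) p.1 * p.2.

Definition null_ideal a : Prop := a = 0.

(* Rings are nonzero here, so "R is not the zero ring" is part of the type. *)
Definition prime_ring : Prop :=
  forall I J, two_sided_ideal I -> two_sided_ideal J ->
    (forall c, ideal_mul I J c -> null_ideal c) ->
    (forall a, I a -> null_ideal a) \/ (forall b, J b -> null_ideal b).

Definition semiprime_ring : Prop :=
  forall I, two_sided_ideal I ->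
    (forall c, ideal_mul I I c -> null_ideal c) ->
    (forall a, I a -> null_ideal a).

End Ideals.

(* A Notation, so that the ring structure of {malg _} is found directly. *)
Notation free_alg k X := {malg k[{fmonom X}]}.

Definition free_gen (k : fieldType) (X : choiceType) (i : X) : free_alg k X :=
  << fmu i >>.

Section Presented.
Variables (k : fieldType) (X : choiceType) (rels : seq (free_alg k X)).
Local Notation F := (free_alg k X).

(* Boolean only through classical choice: membership in the two-sided ideal
   generated by rels is not decidable in general. *)
Definition rel_ideal : {pred F} :=
  fun a => `[< gen_ideal (fun s => s \in rels) a >].

Lemma rel_idealP a :
  reflect (gen_ideal (fun s => s \in rels) a) (a \in rel_ideal).
Proof. exact: asboolP. Qed.

Lemma rel_ideal_zmod_closed : zmod_closed rel_ideal.
Proof.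
have [h0 hB _ _] := gen_ideal_ideal (fun s : F => s \in rels).
split=> [|a b /rel_idealP ha /rel_idealP hb]; apply/rel_idealP => //.
exact: hB.
Qed.

HB.instance Definition _ :=
  GRing.isZmodClosed.Build F rel_ideal rel_ideal_zmod_closed.

Lemma rel_idealMl a b : b \in rel_ideal -> a * b \in rel_ideal.
Proof.
have [_ _ h _] := gen_ideal_ideal (fun s : F => s \in rels).
by move=> /rel_idealP hb; apply/rel_idealP; apply: h.
Qed.

Lemma rel_idealMr a b : a \in rel_ideal -> a * b \in rel_ideal.
Proof.
have [_ _ _ h] := gen_ideal_ideal (fun s : F => s \in rels).
by move=> /rel_idealP ha; apply/rel_idealP; apply: h.
Qed.

(* Two-sided ideals of F are stable under scalars, so the quotient below is the
   k-algebra presented by X and rels. *)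
Lemma rel_idealZ c a : a \in rel_ideal -> c *: a \in rel_ideal.
Proof. by rewrite -mul_malgC; apply: rel_idealMl. Qed.

Definition presented : Type := {quot rel_ideal}.

HB.instance Definition _ := Choice.on presented.
HB.instance Definition _ := EqQuotient.on presented.
HB.instance Definition _ := GRing.Zmodule.on presented.
HB.instance Definition _ := ZmodQuotient.on presented.

Definition pone : presented := lift_cst presented 1.
Definition pmul := lift_op2 presented *%R.
Definition pscale c := lift_op1 presented ( *:%R c).

Canonical pi_pone_morph := PiConst pone.

Lemma pi_pmul : {morph \pi_presented : x y / x * y >-> pmul x y}.
Proof.
move=> x y; unlock pmul; apply/eqP; rewrite -idealrBE.
rewrite -[_ * _](addrNK (x * repr (\pi_presented y))) -mulrBr.
rewrite -addrA -mulrBl rpredD //.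
  by rewrite rel_idealMl // idealrBE reprK.
by rewrite rel_idealMr // idealrBE reprK.
Qed.
Canonical pi_pmul_morph := PiMorph2 pi_pmul.

Lemma pi_pscale c : {morph \pi_presented : x / c *: x >-> pscale c x}.
Proof.
move=> x; unlock pscale; apply/eqP; rewrite -idealrBE -scalerBr.
by rewrite rel_idealZ // idealrBE reprK.
Qed.
Canonical pi_pscale_morph c := PiMorph1 (pi_pscale c).

Lemma pmulA : associative pmul.
Proof. by move=> x y z; rewrite -[x]reprK -[y]reprK -[z]reprK !piE mulrA. Qed.

Lemma pmul1 : left_id pone pmul.
Proof. by move=> x; rewrite -[x]reprK !piE mul1r. Qed.

Lemma pmulr1 : right_id pone pmul.
Proof. by move=> x; rewrite -[x]reprK !piE mulr1. Qed.

Lemma pmulDl : left_distributive pmul +%R.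
Proof.
by move=> x y z; rewrite -[x]reprK -[y]reprK -[z]reprK !piE mulrDl.
Qed.

Lemma pmulDr : right_distributive pmul +%R.
Proof.
by move=> x y z; rewrite -[x]reprK -[y]reprK -[z]reprK !piE mulrDr.
Qed.

HB.instance Definition _ := GRing.Zmodule_isPzRing.Build presented
  pmulA pmul1 pmulr1 pmulDl pmulDr.

Lemma pscaleA c d x : pscale c (pscale d x) = pscale (c * d) x.
Proof. by rewrite -[x]reprK !piE scalerA. Qed.

Lemma pscale1 : left_id 1 pscale.
Proof. by move=> x; rewrite -[x]reprK !piE scale1r. Qed.

Lemma pscaleDr : right_distributive pscale +%R.
Proof. by move=> c x y; rewrite -[x]reprK -[y]reprK !piE scalerDr. Qed.

Lemma pscaleDl x : {morph pscale^~ x : c d / c + d}.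
Proof. by move=> c d /=; rewrite -[x]reprK !piE scalerDl. Qed.

HB.instance Definition _ := GRing.Zmodule_isLmodule.Build k presented
  pscaleA pscale1 pscaleDr pscaleDl.

Lemma pi_presentedM : {morph \pi_presented : x y / x * y}.
Proof. exact: pi_pmul. Qed.

Lemma pi_presentedZ c : {morph \pi_presented : x / c *: x}.
Proof. exact: pi_pscale. Qed.

Lemma pi_presented0 : \pi_presented 0 = 0.
Proof. exact: pi_zeror. Qed.

Lemma pi_presented1 : \pi_presented 1 = 1.
Proof. by change (\pi_presented 1 = pone); rewrite piE. Qed.

Lemma pscaleAl (c : k) (x y : presented) : c *: (x * y) = (c *: x) * y.
Proof.
rewrite -[x]reprK -[y]reprK -pi_presentedM -!pi_presentedZ -pi_presentedM.
by rewrite scalerAl.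
Qed.

Lemma free_scaleAr (c : k) (x y : F) : c *: (x * y) = x * (c *: y).
Proof.
suff cC z : GRing.comm (c%:MP : F) z.
  by rewrite -!mul_malgC mulrA cC -mulrA.
apply/malgP => m; rewrite mul_malgC mcoeffZ malgM_def fgmulgU.
rewrite raddf_sum [in LHS](monalgE z) raddf_sum mulr_sumr /=.
by apply: eq_bigr => w _; rewrite !mcoeffU mulm1 mulrC mulrnAl.
Qed.

Lemma pscaleAr (c : k) (x y : presented) : c *: (x * y) = x * (c *: y).
Proof.
rewrite -[x]reprK -[y]reprK -pi_presentedM -!pi_presentedZ -pi_presentedM.
by rewrite free_scaleAr.
Qed.

End Presented.

Variant gl11_gen := gen_x | gen_y | gen_u | gen_v | gen_t.

Definition gl11_gen_code g : 'I_5 :=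
  match g with
  | gen_x => inord 0 | gen_y => inord 1 | gen_u => inord 2
  | gen_v => inord 3 | gen_t => inord 4
  end.

Definition gl11_gen_decode (i : 'I_5) :=
  nth gen_x [:: gen_x; gen_y; gen_u; gen_v; gen_t] i.

Lemma gl11_gen_codeK : cancel gl11_gen_code gl11_gen_decode.
Proof. by case; rewrite /gl11_gen_decode /= inordK. Qed.

HB.instance Definition _ := Countable.copy gl11_gen (can_type gl11_gen_codeK).

(* U(gl(1,1)) # k C_2 on x = e11 + e22, y = e11, u = e12, v = e21 and the
   generator t of C_2, which acts on the superalgebra by parity; each relation
   a = b is entered as the relator a - b. *)
Definition gl11_relators (R : nzRingType) (x y u v t : R) : seq R :=
  [:: x * y - y * x; x * u - u * x; x * v - v * x;
      (y * u - u * y) - u; (y * v - v * y) - (- v);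
      u ^+ 2; v ^+ 2; (u * v + v * u) - x;
      t ^+ 2 - 1; t * x - x * t; t * y - y * t;
      t * u - (- (u * t)); t * v - (- (v * t))].

Lemma map_gl11_relators (R S : nzRingType) (f : {rmorphism R -> S}) x y u v t :
  [seq f r | r <- gl11_relators x y u v t] =
  gl11_relators (f x) (f y) (f u) (f v) (f t).
Proof.
by rewrite /gl11_relators /= !(rmorphB, rmorphN, rmorphD, rmorphM, rmorphXn,
  rmorph1).
Qed.

Definition gl11_rels (k : fieldType) : seq (free_alg k gl11_gen) :=
  gl11_relators (free_gen k gen_x) (free_gen k gen_y) (free_gen k gen_u)
    (free_gen k gen_v) (free_gen k gen_t).

Definition H_gl11 (k : fieldType) : Type := presented (gl11_rels k).

HB.instance Definition _ k := Choice.on (H_gl11 k).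
HB.instance Definition _ k := GRing.PzRing.on (H_gl11 k).
HB.instance Definition _ k := GRing.Lmodule.on (H_gl11 k).

Section NonZero.
Variable k : fieldType.

(* The augmentation x, y, u, v |-> 0, t |-> 1 shows that H_gl11 k is nonzero. *)
Definition aug_word (w : {fmonom gl11_gen}) : k :=
  (all (pred1 gen_t) (w : seq gl11_gen))%:R.

Lemma aug_word_mmorphism : mmorphism aug_word.
Proof.
split=> [w1 w2|]; last by rewrite /aug_word fm1.
by rewrite /aug_word fmM all_cat -natrM mulnb.
Qed.

HB.instance Definition _ :=
  isMultiplicative.Build _ _ aug_word aug_word_mmorphism.

Local Notation aug := (mmap idfun aug_word : free_alg k gl11_gen -> k).

Lemma aug_gen i : aug (free_gen k i) = (i == gen_t)%:R.
Proof. by rewrite /free_gen mmapU mul1r /= /aug_word fmU /= andbT. Qed.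

Lemma aug_rel_ideal a : a \in rel_ideal (gl11_rels k) -> aug a = 0.
Proof.
move=> /rel_idealP /(_ (fun a => aug a = 0)); apply.
  split=> [|b c hb hc|b c hc|b c hb].
  - exact: rmorph0.
  - by rewrite rmorphB /= hb hc subrr.
  - by rewrite rmorphM /= hc mulr0.
  - by rewrite rmorphM /= hb mul0r.
move=> s hs; pose f : {rmorphism free_alg k gl11_gen -> k} := mmap idfun aug_word.
have fg i : f (free_gen k i) = if i is gen_t then 1 else 0.
  by rewrite [LHS]aug_gen; case: i => //; rewrite ?eqxx //;
    case: eqP.
have : f s \in [seq f r | r <- gl11_rels k] by apply: map_f.
rewrite map_gl11_relators !fg /gl11_relators /= !(expr0n, expr1n, mulr0, mul0r,
  oppr0, subr0, addr0, mul1r, subrr).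
by rewrite !inE !orbb => /eqP.
Qed.

Lemma H_gl11_neq0 : (1 : H_gl11 k) != 0.
Proof.
apply/eqP; change ((1 : presented (gl11_rels k)) <> 0).
rewrite -pi_presented1 -pi_presented0 => /eqP.
rewrite -idealrBE subr0 => /aug_rel_ideal; rewrite rmorph1 => /eqP.
by rewrite oner_eq0.
Qed.

HB.instance Definition _ :=
  GRing.PzSemiRing_isNonZero.Build (H_gl11 k) H_gl11_neq0.
HB.instance Definition _ := GRing.Lmodule_isLalgebra.Build k (H_gl11 k)
  (@pscaleAl k gl11_gen (gl11_rels k)).
HB.instance Definition _ := GRing.Lalgebra_isAlgebra.Build k (H_gl11 k)
  (@pscaleAr k gl11_gen (gl11_rels k)).

End NonZero.

(* Main.v *)
Require Import Defs.
From HB Require Import structures.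
From mathcomp Require Import all_boot all_algebra.
From mathcomp Require Import monalg ring.

(* Let A = k[x, y].  For s = 1 and s = -1 the algebra H acts on A^2 by
   x |-> x, y |-> diag(y + 1, y), u |-> e12, v |-> x e21, t |-> s diag(1, -1).
   H is spanned over A by {1, u, v, uv} x {1, t}, and comparing matrix entries
   shows that the two representations are jointly faithful when 2 <> 0.
   Each image contains x e_ij for all i and j, and (M (x e_ji) M)_ij =
   x (M_ij)^2 in the domain A, so an element w with w H w = 0 is killed by both
   representations: H is semiprime.  The kernels of the two representations
   have product zero, and are nonzero because t (x - 2uv), whose square is x^2,
   acts as - s x. *)

Set Implicit Arguments.
Unset Strict Implicit.
Unset Printing Implicit Defensive.

Import GRing.Theory Quotient.
Local Open Scope ring_scope.
Local Open Scope quotient_scope.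

(** * Ring morphisms out of a free algebra *)

Section WordMap.
Variables (X : choiceType) (S : nzRingType) (g : X -> S).

Definition word_map (w : {fmonom X}) : S := \prod_(i <- (w : seq X)) g i.

Lemma word_map_mmorphism : mmorphism word_map.
Proof.
split=> [w1 w2|]; last by rewrite /word_map fm1 big_nil.
by rewrite /word_map fmM big_cat.
Qed.

HB.instance Definition _ :=
  isMultiplicative.Build _ _ word_map word_map_mmorphism.

End WordMap.

Section FreeMap.
Variables (k : fieldType) (X : choiceType) (S : nzRingType).
Variables (c : {rmorphism k -> S}) (g : X -> S).
Hypothesis cC : forall a s, GRing.comm (c a) s.

(** The proof of centrality is an argument so that the ring morphism structure, which depends on it,
    can be inferred from the term [free_map cC]. *)
Definition free_map of (forall a s, GRing.comm (c a) s) :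
  free_alg k X -> S := mmap c (word_map g).

HB.instance Definition _ := GRing.Additive.on (free_map cC).

Lemma free_map_multiplicative : monoid_morphism (free_map cC).
Proof.
have [hM h1] : multiplicative (free_map cC).
  by apply: commr_mmap_is_multiplicative => *; apply: cC.
by split.
Qed.
HB.instance Definition _ := GRing.isMonoidMorphism.Build (free_alg k X) S
  (free_map cC) free_map_multiplicative.

Lemma free_map_gen i : free_map cC (free_gen k i) = g i.
Proof.
by rewrite /free_map /free_gen mmapU /= rmorph1 mul1r /word_map fmU big_seq1.
Qed.

Lemma free_map_const a : free_map cC a%:MP = c a.
Proof. exact: mmapC. Qed.

End FreeMap.

(** * Kernels and induction for presented algebras *)

Section Presented.
Variables (k : fieldType) (X : choiceType) (rels : seq (free_alg k X)).
Local Notation F := (free_alg k X).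
Local Notation P := (presented rels).

(** The kernel of [f] is one of the ideals over which [gen_ideal] quantifies. *)
Lemma rel_ideal_ker (S : nzRingType) (f : {rmorphism F -> S}) :
  (forall r, r \in rels -> f r = 0) -> forall a, a \in rel_ideal rels -> f a = 0.
Proof.
move=> f0 a /rel_idealP /(_ (fun a => f a = 0)); apply; last exact: f0.
split=> [|b d hb hd|b d hd|b d hb]; first exact: rmorph0.
- by rewrite rmorphB hb hd subrr.
- by rewrite rmorphM hd mulr0.
- by rewrite rmorphM hb mul0r.
Qed.

(** Every element is the class of a linear combination of words, and a word grows by one letter on
    the left at a time. *)
Lemma presented_ind (Q : P -> Prop) :
    Q 1 -> (forall a b, Q a -> Q b -> Q (a + b)) ->
    (forall (c : k) a, Q a -> Q (c *: a)) ->
    (forall i a, Q a -> Q (\pi_P (free_gen k i) * a)) ->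
  forall a, Q a.
Proof.
move=> Q1 QD QZ Qg a; rewrite -[a]reprK [repr a]monalgE.
have piD : {morph \pi_P : b c / b + c} by move=> b c; rewrite !piE.
elim: (X in \sum_(w <- X) _) => [|w s IH].
  (* The empty sum is covered by the scaling hypothesis, as [0 *: 1]. *)
  rewrite big_nil; suff -> : \pi_P 0 = 0 *: (1 : P) by apply: QZ.
  by rewrite scale0r pi_presented0.
rewrite big_cons piD; apply: QD => //.
have -> : << (repr a)@_w *g w >> = (repr a)@_w *: << w >> :> F.
  by rewrite -mul_malgC malgM_def fgmulUU mulr1 mul1m.
rewrite pi_presentedZ; apply: QZ; case: w => w; elim: w => [|i w IHw].
  rewrite (_ : << _ >> = 1) ?pi_presented1 //.
  by congr << _ *g _ >>; apply/eqP; rewrite fmP fm1.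
rewrite (_ : << _ >> = free_gen k i * << FMonom w >>).
  by rewrite pi_presentedM; apply: Qg.
rewrite /free_gen malgM_def fgmulUU mulr1; congr << _ *g _ >>.
by apply/eqP; rewrite fmP fmM fmU.
Qed.

End Presented.

(** * The universal property of [H_gl11] *)

Section HMaps.
Variable k : fieldType.
Local Notation F := (free_alg k gl11_gen).
Local Notation H := (H_gl11 k).

Definition H_pi (a : F) : H := \pi_(presented (gl11_rels k)) a.

Lemma H_pi_additive : additive H_pi.
Proof. by move=> a b; rewrite /H_pi !piE. Qed.
HB.instance Definition _ := GRing.isAdditive.Build F H H_pi H_pi_additive.

Lemma H_pi_multiplicative : monoid_morphism H_pi.
Proof. by split=> [|a b]; rewrite /H_pi ?pi_presented1 ?pi_presentedM. Qed.
HB.instance Definition _ :=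
  GRing.isMonoidMorphism.Build F H H_pi H_pi_multiplicative.

Definition H_gen i : H := H_pi (free_gen k i).

Definition gl11_relations (R : nzRingType) (x y u v t : R) : Prop :=
  forall r, r \in gl11_relators x y u v t -> r = 0.

Lemma H_relations : gl11_relations (H_gen gen_x) (H_gen gen_y) (H_gen gen_u)
  (H_gen gen_v) (H_gen gen_t).
Proof.
move=> r; rewrite -map_gl11_relators => /mapP[s hs ->].
apply/eqP; rewrite -(rmorph0 H_pi) -idealrBE subr0.
by apply/rel_idealP; apply: gen_ideal_sub.
Qed.

Lemma H_ind (Q : H -> Prop) :
    Q 1 -> (forall a b, Q a -> Q b -> Q (a + b)) ->
    (forall (c : k) a, Q a -> Q (c *: a)) ->
    (forall i a, Q a -> Q (H_gen i * a)) ->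
  forall a, Q a.
Proof. exact: presented_ind. Qed.

(** The target is a plain ring with a central image of [k]: it will be a matrix ring over
    [{poly {poly k}}], where scalars enter as doubly constant polynomials. *)
Lemma H_lift (S : nzRingType) (c : {rmorphism k -> S}) (x y u v t : S) :
    (forall a s, GRing.comm (c a) s) -> gl11_relations x y u v t ->
  exists f : {rmorphism H -> S},
    [/\ f (H_gen gen_x) = x, f (H_gen gen_y) = y, f (H_gen gen_u) = u,
        f (H_gen gen_v) = v & f (H_gen gen_t) = t] /\
    forall a, f a%:A = c a.
Proof.
move=> cC rel.
pose g i := match i with
  | gen_x => x | gen_y => y | gen_u => u | gen_v => v | gen_t => t end.
pose f0 : {rmorphism F -> S} := free_map g cC.
have ker a : a \in rel_ideal (gl11_rels k) -> f0 a = 0.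
  apply: rel_ideal_ker => r hr; apply: rel.
  have fg i : f0 (free_gen k i) = g i by exact: free_map_gen.
  have : f0 r \in [seq f0 a | a <- gl11_rels k] by apply: map_f.
  by rewrite map_gl11_relators !fg.
pose f (h : H) := f0 (repr (h : presented (gl11_rels k))).
(* The chosen representative of [H_pi a] differs from [a] by an element of the relation ideal, which
   [f0] kills. *)
have fpi a : f (H_pi a) = f0 a.
  apply/eqP; rewrite -subr_eq0 -rmorphB; apply/eqP/ker.
  by rewrite idealrBE reprK.
have piK (h : H) : exists a, h = H_pi a.
  by exists (repr (h : presented (gl11_rels k))); rewrite /H_pi reprK.
have fB : additive f.
  move=> a b; have [{}a ->] := piK a; have [{}b ->] := piK b.
  by rewrite -rmorphB !fpi rmorphB.
have fM : monoid_morphism f.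
  split=> [|a b]; first by rewrite -(rmorph1 H_pi) fpi rmorph1.
  have [{}a ->] := piK a; have [{}b ->] := piK b.
  by rewrite -rmorphM !fpi rmorphM.
pose fA := GRing.isAdditive.Build H S f fB.
pose fR := GRing.isMonoidMorphism.Build H S f fM.
pose ff : {rmorphism H -> S} := HB.pack f fA fR.
exists ff; split; first by split; rewrite /= fpi [LHS]free_map_gen.
move=> a; rewrite /=.
have -> : (a%:A : H) = H_pi a%:MP.
  by rewrite -[_%:MP]mulr1 mul_malgC [RHS]pi_presentedZ
    -[\pi_ _ 1]/(H_pi 1) rmorph1.
by rewrite fpi [LHS]free_map_const.
Qed.
End HMaps.

Lemma ker_ideal (R S : nzRingType) (f : {rmorphism R -> S}) :
  two_sided_ideal (fun a => f a = 0).
Proof.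
split=> [|a b ha hb|a b hb|a b ha]; first exact: rmorph0.
- by rewrite rmorphB ha hb subrr.
- by rewrite rmorphM hb mulr0.
- by rewrite rmorphM ha mul0r.
Qed.

(** * A spanning set of Poincare-Birkhoff-Witt type *)

Section Spanning.
Variables (k : fieldType) (B : algType k) (x y u v t : B).
Hypothesis rel : gl11_relations x y u v t.
Local Notation A := {poly {poly k}}.

(** The relators turned into rewriting rules; [v * u = x - u * v] sorts [u] before [v], and the
    rules for [t] move it to the right. *)
Lemma gl11_relE :
  [/\ x * y = y * x, x * u = u * x, x * v = v * x, y * u = u * y + u &
      y * v = v * y - v] /\
  [/\ u * u = 0, v * v = 0, v * u = x - u * v & t * t = 1] /\
  [/\ t * x = x * t, t * y = y * t, t * u = - (u * t) & t * v = - (v * t)].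
Proof.
have H n : (n < 13)%N -> (gl11_relators x y u v t)`_n = 0.
  by move=> ?; apply/rel/mem_nth.
(split; last split); split; apply/eqP; rewrite -subr_eq0; apply/eqP.
- exact: (H 0).
- exact: (H 1).
- exact: (H 2).
- by rewrite opprD addrA; apply: (H 3).
- by rewrite opprD addrA; apply: (H 4).
- by rewrite subr0; apply: (H 5).
- by rewrite subr0; apply: (H 6).
- by rewrite opprB addrCA addrA; apply: (H 7).
- exact: (H 8).
- exact: (H 9).
- exact: (H 10).
- exact: (H 11).
- exact: (H 12).
Qed.

Lemma commr_horner_alg_y : commr_rmorph (horner_alg x) y.
Proof.
have [[xy _ _ _ _] _] := gl11_relE.
move=> p; rewrite /GRing.comm; elim/poly_ind: p => [|p c IH].
  by rewrite rmorph0 mulr0 mul0r.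
rewrite rmorphD rmorphM /= horner_algX horner_algC mulrDl mulrDr.
by rewrite mulrA IH -!mulrA xy mulr_algl mulr_algr.
Qed.

(** [A] is read as k[x][y]: the inner variable ['X%:P] goes to [x] and the outer variable ['X] to
    [y]. *)
Definition ev : A -> B := horner_morph commr_horner_alg_y.
HB.instance Definition _ := GRing.RMorphism.on ev.

Lemma evX : ev 'X = y.
Proof. exact: horner_morphX. Qed.
Lemma evXC : ev 'X%:P = x.
Proof. by rewrite /ev horner_morphC [LHS]horner_algX. Qed.
Lemma evCC c : ev c%:P%:P = c%:A.
Proof. by rewrite /ev horner_morphC [LHS]horner_algC. Qed.

Lemma ev_ind (Q : A -> Prop) :
    (forall c, Q c%:P%:P) -> (forall p q, Q p -> Q q -> Q (p + q)) ->
    (forall p, Q p -> Q (p * 'X%:P)) -> (forall p, Q p -> Q (p * 'X)) ->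
  forall p, Q p.
Proof.
move=> QC QD Qx Qy; elim/poly_ind => [|p c IH]; first exact: (QC 0).
apply: (QD); first exact: Qy.
elim/poly_ind: c => [|q c IHq]; first exact: (QC 0).
by rewrite polyCD polyCM; apply: QD => //; apply: Qx.
Qed.

(** Since u y = (y - 1) u, the polynomial [q] is p(x, y - 1). *)
Lemma u_ev p : exists q, u * ev p = ev q * u.
Proof.
have [[_ xu _ yu _] _] := gl11_relE.
elim/ev_ind: p => [c|p q [p' hp] [q' hq]|p [q hq]|p [q hq]].
- by exists c%:P%:P; rewrite !evCC mulr_algl mulr_algr.
- by exists (p' + q'); rewrite !rmorphD mulrDr mulrDl hp hq.
- by exists (q * 'X%:P); rewrite !rmorphM /= evXC mulrA hq -!mulrA xu.
- exists (q * ('X - 1)); rewrite !rmorphM rmorphB rmorph1 /= evX mulrA hq.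
  by rewrite -!mulrA mulrBl mul1r yu addrK.
Qed.

(** Since v y = (y + 1) v, the polynomial [q] is p(x, y + 1). *)
Lemma v_ev p : exists q, v * ev p = ev q * v.
Proof.
have [[_ _ xv _ yv] _] := gl11_relE.
elim/ev_ind: p => [c|p q [p' hp] [q' hq]|p [q hq]|p [q hq]].
- by exists c%:P%:P; rewrite !evCC mulr_algl mulr_algr.
- by exists (p' + q'); rewrite !rmorphD mulrDr mulrDl hp hq.
- by exists (q * 'X%:P); rewrite !rmorphM /= evXC mulrA hq -!mulrA xv.
- exists (q * ('X + 1)); rewrite !rmorphM rmorphD rmorph1 /= evX mulrA hq.
  by rewrite -!mulrA mulrDl mul1r yv subrK.
Qed.

Lemma t_ev p : t * ev p = ev p * t.
Proof.
have [_ [_ [tx ty _ _]]] := gl11_relE.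
elim/ev_ind: p => [c|p q hp hq|p hq|p hq].
- by rewrite !evCC mulr_algl mulr_algr.
- by rewrite !rmorphD mulrDr mulrDl hp hq.
- by rewrite !rmorphM /= evXC mulrA hq -!mulrA tx.
- by rewrite !rmorphM /= evX mulrA hq -!mulrA ty.
Qed.

(** The part without [t], that is, the image of U(gl(1,1)); [even] does not refer to parity, as odd
    words occur too. *)
Definition even_span (b : B) := exists p0 p1 p2 p3,
  b = ev p0 + ev p1 * u + ev p2 * v + ev p3 * (u * v).

Definition pbw_span (b : B) :=
  exists2 b0, even_span b0 & exists2 b1, even_span b1 & b = b0 + b1 * t.

Lemma even_spanD a b : even_span a -> even_span b -> even_span (a + b).
Proof.
move=> [p0 [p1 [p2 [p3 ->]]]] [q0 [q1 [q2 [q3 ->]]]].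
exists (p0 + q0), (p1 + q1), (p2 + q2), (p3 + q3).
rewrite !rmorphD !mulrDl addrACA; congr (_ + _); rewrite addrACA; congr (_ + _).
exact: addrACA.
Qed.

Lemma even_span_ev p b : even_span b -> even_span (ev p * b).
Proof.
move=> [p0 [p1 [p2 [p3 ->]]]]; exists (p * p0), (p * p1), (p * p2), (p * p3).
by rewrite !rmorphM !mulrDr !mulrA.
Qed.

Lemma even_span_u b : even_span b -> even_span (u * b).
Proof.
have [_ [[uu _ _ _] _]] := gl11_relE.
move=> [p0 [p1 [p2 [p3 ->]]]].
have [q0 h0] := u_ev p0; have [q1 h1] := u_ev p1.
have [q2 h2] := u_ev p2; have [q3 h3] := u_ev p3.
(* By u^2 = 0 the terms in u and uv die; the constant and v terms become q0 u and q2 uv. *)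
exists 0, q0, 0, q2; rewrite !rmorph0 !mulrDr !mulrA h0 h1 h2 h3 -!mulrA.
by rewrite uu [u * (u * v)]mulrA uu !mul0r !mulr0 !addr0 !add0r.
Qed.

Lemma even_span_v b : even_span b -> even_span (v * b).
Proof.
have [_ [[_ vv vu _] _]] := gl11_relE.
move=> [p0 [p1 [p2 [p3 ->]]]].
have [q0 h0] := v_ev p0; have [q1 h1] := v_ev p1.
have [q2 h2] := v_ev p2; have [q3 h3] := v_ev p3.
(* Here q1 vu = q1 x - q1 uv, v^2 = 0 kills the v term, and vuv = (x - uv) v = x v. *)
exists (q1 * 'X%:P), 0, (q0 + q3 * 'X%:P), (- q1).
rewrite !(rmorph0, rmorphD, rmorphN, rmorphM) /= evXC !mulrDr !mulrA h0 h1 h2 h3.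
rewrite -!mulrA vv [v * (u * v)]mulrA vu mulrBl -!mulrA vv !mulr0 !mul0r.
rewrite subr0 addr0 mulrBr mulrDl mulNr -!mulrA addr0.
by rewrite addrCA -!addrA [- _ + _]addrC.
Qed.

(** Conjugation by [t] is the parity automorphism: it negates the coefficients of the odd words u
    and v. *)
Lemma even_span_t b : even_span b -> exists2 b', even_span b' & t * b = b' * t.
Proof.
have [_ [_ [_ _ tu tv]]] := gl11_relE.
move=> [p0 [p1 [p2 [p3 ->]]]].
exists (ev p0 + ev (- p1) * u + ev (- p2) * v + ev p3 * (u * v)).
  by exists p0, (- p1), (- p2), p3.
rewrite !mulrDr !mulrDl !mulrA !t_ev !rmorphN !mulNr -!mulrA tu tv.
by rewrite !mulrN [t * (u * v)]mulrA tu mulNr -mulrA tv !mulrN opprK.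
Qed.

Lemma even_span1 : even_span 1.
Proof. by exists 1, 0, 0, 0; rewrite rmorph1 rmorph0 !mul0r !addr0. Qed.

Lemma even_span0 : even_span 0.
Proof. by exists 0, 0, 0, 0; rewrite rmorph0 !mul0r !addr0. Qed.

Lemma pbw_span1 : pbw_span 1.
Proof.
exists 1; first exact: even_span1.
by exists 0; [exact: even_span0 | rewrite mul0r addr0].
Qed.

Lemma pbw_spanD a b : pbw_span a -> pbw_span b -> pbw_span (a + b).
Proof.
move=> [a0 h0 [a1 h1 ->]] [b0 g0 [b1 g1 ->]].
exists (a0 + b0); first exact: even_spanD.
by exists (a1 + b1); [exact: even_spanD | rewrite mulrDl addrACA].
Qed.

Lemma pbw_span_ev p b : pbw_span b -> pbw_span (ev p * b).
Proof.
move=> [b0 h0 [b1 h1 ->]]; exists (ev p * b0); first exact: even_span_ev.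
by exists (ev p * b1); [exact: even_span_ev | rewrite mulrDr mulrA].
Qed.

Lemma pbw_span_u b : pbw_span b -> pbw_span (u * b).
Proof.
move=> [b0 h0 [b1 h1 ->]]; exists (u * b0); first exact: even_span_u.
by exists (u * b1); [exact: even_span_u | rewrite mulrDr mulrA].
Qed.

Lemma pbw_span_v b : pbw_span b -> pbw_span (v * b).
Proof.
move=> [b0 h0 [b1 h1 ->]]; exists (v * b0); first exact: even_span_v.
by exists (v * b1); [exact: even_span_v | rewrite mulrDr mulrA].
Qed.

Lemma pbw_span_t b : pbw_span b -> pbw_span (t * b).
Proof.
have [_ [[_ _ _ tt] _]] := gl11_relE.
move=> [b0 h0 [b1 h1 ->]].
have [c0 hc0 e0] := even_span_t h0; have [c1 hc1 e1] := even_span_t h1.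
(* Since t^2 = 1, t (b0 + b1 t) = c1 + c0 t: the two halves trade places. *)
exists c1 => //; exists c0 => //.
by rewrite mulrDr mulrA e0 e1 -mulrA tt mulr1 addrC.
Qed.

End Spanning.

(** * Two-by-two matrices and the defining relations *)

Section Mx2.
Variable R : comNzRingType.
Definition mx2 (a b c d : R) : 'M[R]_2 :=
  \matrix_(i, j) if i == 0 then (if j == 0 then a else b)
                 else (if j == 0 then c else d).

Lemma mx2_mul a b c d a' b' c' d' : mx2 a b c d * mx2 a' b' c' d' =
  mx2 (a * a' + b * c') (a * b' + b * d') (c * a' + d * c') (c * b' + d * d').
Proof.
by apply/matrixP=> i j; rewrite !mxE big_ord_recl big_ord1 !mxE /=;
  case: (i == 0); case: (j == 0).
Qed.
Lemma mx2_add a b c d a' b' c' d' : mx2 a b c d + mx2 a' b' c' d' =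
  mx2 (a + a') (b + b') (c + c') (d + d').
Proof. by apply/matrixP=> i j; rewrite !mxE; do 2!case: ifP. Qed.
Lemma mx2_opp a b c d : - mx2 a b c d = mx2 (- a) (- b) (- c) (- d).
Proof. by apply/matrixP=> i j; rewrite !mxE; do 2!case: ifP. Qed.
Lemma mx2_scalar a : a%:M = mx2 a 0 0 a.
Proof.
apply/matrixP=> i j; rewrite !mxE.
by case: i => [[|[|[]]]] //= ?; case: j => [[|[|[]]]].
Qed.
Lemma mx2_eq0 a b c d : mx2 a b c d = 0 -> [/\ a = 0, b = 0, c = 0 & d = 0].
Proof.
move/matrixP => h.
by have := (h 0 0, h 0 1, h 1 0, h 1 1); rewrite !mxE /= => -[[[-> ->] ->] ->].
Qed.

Lemma mx2_relations (a b s : R) : s * s = 1 ->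
  gl11_relations (mx2 a 0 0 a) (mx2 (b + 1) 0 0 b) (mx2 0 1 0 0)
    (mx2 0 0 a 0) (mx2 s 0 0 (- s)).
Proof.
move=> ss r.
have e1 : 1 = mx2 1 0 0 1 :> 'M[R]_2 by exact: mx2_scalar.
have z : mx2 0 0 0 0 = 0 :> 'M[R]_2 by rewrite -mx2_scalar raddf0.
rewrite /gl11_relators !expr2 e1.
rewrite !mx2_mul !(mx2_opp, mx2_add) -z !inE.
by do !(case/predU1P => [->|]; first by congr mx2; rewrite ?mulrNN ?ss; ring);
  move/eqP => ->; congr mx2; ring.
Qed.
End Mx2.

Lemma mulmx_delta_sandwich (R : comNzRingType) n (M : 'M[R]_n) i j (c : R) :
  (M *m (c *: delta_mx j i) *m M) i j = c * M i j ^+ 2.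
Proof.
(* [delta_mx j i] factors as a column times a row through dimension one, so the product is column j
   of [M] times row i of [M]. *)
rewrite -scalemxAr -scalemxAl mxE -(mul_delta_mx (0 : 'I_1)).
by rewrite mulmxA -(mulmxA (M *m _)) -rowE -colE mxE big_ord1 !mxE expr2.
Qed.

(** * The two representations on A^2 *)

Section Representations.
Variable k : fieldType.
Local Notation H := (H_gl11 k).
Local Notation A := {poly {poly k}}.
Local Notation hx := (H_gen k gen_x).
Local Notation hy := (H_gen k gen_y).
Local Notation hu := (H_gen k gen_u).
Local Notation hv := (H_gen k gen_v).
Local Notation ht := (H_gen k gen_t).

Lemma H_pbw (h : H) : pbw_span (@H_relations k) h.
Proof.
elim/H_ind: h => [|a b ha hb|c a ha|i a ha].
- exact: pbw_span1.
- exact: pbw_spanD.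
- by have := pbw_span_ev c%:P%:P ha; rewrite evCC mulr_algl.
case: i.
- by have := pbw_span_ev 'X%:P ha; rewrite evXC.
- by have := pbw_span_ev 'X ha; rewrite evX.
- exact: pbw_span_u.
- exact: pbw_span_v.
- exact: pbw_span_t.
Qed.

Definition H_rep_spec (s : A) (f : H -> 'M[A]_2) :=
    [/\ f hx = mx2 'X%:P 0 0 'X%:P, f hy = mx2 ('X + 1) 0 0 'X,
        f hu = mx2 0 1 0 0, f hv = mx2 0 0 'X%:P 0 &
        f ht = mx2 s 0 0 (- s)] /\
    forall a, f a%:A = (a%:P%:P)%:M.

Lemma H_rep (s : A) : s * s = 1 ->
  exists f : {rmorphism H -> 'M[A]_2}, H_rep_spec s f.
Proof.
move=> ss.
pose c : {rmorphism k -> 'M[A]_2} := @scalar_mx A 2 \o polyC \o polyC.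
have cC a M : GRing.comm (c a) M by apply/esym/scalar_mxC.
have [f [fg fc]] := H_lift cC (mx2_relations (a := 'X%:P) (b := 'X) ss).
by exists f; split=> [|a]; [exact: fg | exact: fc].
Qed.

(** The substitution y |-> y + 1: [y] acts by y + 1 on the first basis vector and by y on the
    second. *)
Definition shift (p : A) : A := p \Po ('X + 1).

Lemma rep_ev s (f : {rmorphism H -> 'M[A]_2}) p :
  H_rep_spec s f -> f (ev (@H_relations k) p) = mx2 (shift p) 0 0 p.
Proof.
move=> [[fx fy _ _ _] fc]; rewrite /shift.
elim/ev_ind: p => [c|p q hp hq|p hp|p hp].
- by rewrite evCC fc comp_polyC mx2_scalar.
- by rewrite !rmorphD hp hq mx2_add !addr0.
- by rewrite !rmorphM /= evXC fx hp mx2_mul comp_polyC; congr mx2; ring.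
- by rewrite !rmorphM /= evX fy hp mx2_mul comp_polyX; congr mx2; ring.
Qed.

Lemma shift_eq0 (p : A) : shift p = 0 -> p = 0.
Proof. by move=> h; rewrite -(comp_polyXaddC_K p 1) [X in X \Po _]h comp_poly0. Qed.

(** As uv acts by x e11, the entries determine all coefficients: p0, p1 and p2 come from (2,2),
    (1,2) and (2,1), and then p3 from (1,1). *)
Lemma rep_even s (f : {rmorphism H -> 'M[A]_2}) p0 p1 p2 p3 :
  H_rep_spec s f ->
  f (ev (@H_relations k) p0 + ev (@H_relations k) p1 * hu
     + ev (@H_relations k) p2 * hv
     + ev (@H_relations k) p3 * (hu * hv)) =
  mx2 (shift p0 + shift p3 * 'X%:P) (shift p1) (p2 * 'X%:P) p0.
Proof.
move=> fs; rewrite 3!(rmorphD f) 4!(rmorphM f) !(rep_ev _ fs).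
have [[_ _ -> -> _] _] := fs.
by rewrite !mx2_mul !mx2_add; congr mx2; ring.
Qed.

Lemma rep_delta s (f : {rmorphism H -> 'M[A]_2}) i j :
  H_rep_spec s f -> exists h, f h = 'X%:P *: delta_mx i j.
Proof.
move=> [[fx _ fu fv _] _].
(* The elements uv, xu, v and vu act as x e11, x e12, x e21 and x e22. *)
exists (if i == 0 then if j == 0 then hu * hv else hx * hu
        else if j == 0 then hv else hv * hu).
have -> : 'X%:P *: delta_mx i j = mx2 ('X%:P *+ ((i == 0) && (j == 0)))
    ('X%:P *+ ((i == 0) && (j != 0))) ('X%:P *+ ((i != 0) && (j == 0)))
    ('X%:P *+ ((i != 0) && (j != 0))) :> 'M[A]_2.
  apply/matrixP=> i' j'; rewrite !mxE.
  have dich (l : 'I_2) : l = 0 \/ l = 1.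
    by case: l => [[|[|[]]]] // ?; [left|right]; apply: val_inj.
  by case: (dich i) (dich j) (dich i') (dich j') => -> [] -> [] -> [] -> /=;
    rewrite ?mulr1 ?mulr0.
case: (i == 0); case: (j == 0) => /=.
- by rewrite (rmorphM f) fu fv mx2_mul; congr mx2; ring.
- by rewrite (rmorphM f) fx fu mx2_mul; congr mx2; ring.
- by rewrite fv !mulr0n.
- by rewrite (rmorphM f) fu fv mx2_mul; congr mx2; ring.
Qed.

Lemma rep_sandwich_eq0 s (f : {rmorphism H -> 'M[A]_2}) (w : H) :
  H_rep_spec s f -> (forall h, w * (h * w) = 0) -> f w = 0.
Proof.
move=> fs w0; apply/matrixP=> i j; rewrite [RHS]mxE.
have [h fh] := rep_delta j i fs.
have : f (w * (h * w)) = 0 by rewrite w0 rmorph0.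
rewrite !rmorphM fh mulrA => /matrixP/(_ i j).
rewrite [LHS]mulmx_delta_sandwich [RHS]mxE => /eqP.
by rewrite mulf_eq0 polyC_eq0 polyX_eq0 /= expf_eq0 => /eqP.
Qed.

(** The factor x - 2uv acts as diag(-x, x); multiplying by [t], which acts as s diag(1, -1), makes
    it scalar. *)
Definition central_root : H := ht * (hx - (hu * hv) *+ 2).

Lemma rep_central_root s (f : {rmorphism H -> 'M[A]_2}) :
  H_rep_spec s f -> f central_root = mx2 (- s * 'X%:P) 0 0 (- s * 'X%:P).
Proof.
move=> [[fx _ fu fv ft] _].
rewrite (rmorphM f) (rmorphB f) (rmorphMn f) (rmorphM f) fx fu fv ft.
rewrite mulr2n !(mx2_mul, mx2_add, mx2_opp).
by congr mx2; ring.
Qed.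

(** * Joint faithfulness, semiprimeness and failure of primeness *)

Section OddCharacteristic.
Hypothesis two_neq0 : 2%:R != 0 :> k.

Lemma add_sub_eq0 (p q : A) : p + q = 0 -> p - q = 0 -> p = 0 /\ q = 0.
Proof.
have tA : 2%:R != 0 :> A by rewrite -!polyC_natr !polyC_eq0.
move=> hD hB.
have p0 : p = 0.
  have : 2%:R * p = 0.
    by transitivity (p + q + (p - q)); [ring | rewrite hD hB addr0].
  by move/eqP; rewrite mulf_eq0 (negbTE tA) => /eqP.
by split=> //; move: hD; rewrite p0 add0r.
Qed.

Lemma rep_faithful (f g : {rmorphism H -> 'M[A]_2}) (h : H) :
  H_rep_spec 1 f -> H_rep_spec (-1) g -> f h = 0 -> g h = 0 -> h = 0.
Proof.
move=> fs gs.
have [_ [p0 [p1 [p2 [p3 ->]]]] [_ [q0 [q1 [q2 [q3 ->]]]] ->]] := H_pbw h.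
rewrite (rmorphD f) (rmorphM f) !(rep_even _ _ _ _ fs).
rewrite (rmorphD g) (rmorphM g) !(rep_even _ _ _ _ gs).
have [[_ _ _ _ ->] _] := fs; have [[_ _ _ _ ->] _] := gs.
rewrite !mx2_mul !mx2_add.
move=> /mx2_eq0[f1 f2 f3 f4] /mx2_eq0[g1 g2 g3 g4].
have X0 : 'X%:P != 0 :> A by rewrite polyC_eq0 polyX_eq0.
(* The sign in [t] makes [f] give differences and [g] sums in the second column, and the reverse in
   the first. Entry (2,2) goes first, so that p0 and q0 drop out of entry (1,1). *)
have [e1 e2] : p0 = 0 /\ q0 = 0.
  by apply: add_sub_eq0; [rewrite -[RHS]g4|rewrite -[RHS]f4]; ring.
subst p0 q0.
have sh0 : shift 0 = 0 :> A by rewrite /shift comp_poly0.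
have [/shift_eq0 -> /shift_eq0 ->] : shift p1 = 0 /\ shift q1 = 0.
  by apply: add_sub_eq0; [rewrite -[RHS]g2|rewrite -[RHS]f2]; ring.
have [/eqP] : p2 * 'X%:P = 0 /\ q2 * 'X%:P = 0.
  by apply: add_sub_eq0; [rewrite -[RHS]f3|rewrite -[RHS]g3]; ring.
rewrite mulf_eq0 (negbTE X0) orbF => /eqP ->.
move/eqP; rewrite mulf_eq0 (negbTE X0) orbF => /eqP ->.
have [/eqP] : shift p3 * 'X%:P = 0 /\ shift q3 * 'X%:P = 0.
  by apply: add_sub_eq0; [rewrite -[RHS]f1|rewrite -[RHS]g1]; rewrite sh0; ring.
rewrite mulf_eq0 (negbTE X0) orbF => /eqP/shift_eq0 ->.
move/eqP; rewrite mulf_eq0 (negbTE X0) orbF => /eqP/shift_eq0 ->.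
by rewrite rmorph0 !(mul0r, addr0).
Qed.

Lemma H_semiprime : semiprime_ring H.
Proof.
move=> I [_ _ Il _] II w Iw.
have [f fs] := H_rep (mulr1 (1 : A)).
have [g gs] := H_rep (etrans (mulrNN 1 1) (mulr1 (1 : A))).
have w0 h : w * (h * w) = 0.
  (* As [h * w] lies in [I], the product w (h w) is a one-term sum in the square of [I]. *)
  apply: II; exists [:: (w, h * w)]; last by rewrite big_seq1.
  by move=> p; rewrite inE => /eqP -> /=; split=> //; apply: Il.
by apply: (rep_faithful fs gs);
  [apply: (rep_sandwich_eq0 fs) | apply: (rep_sandwich_eq0 gs)].
Qed.

Lemma H_not_prime : ~ prime_ring H.
Proof.
have [f fs] := H_rep (mulr1 (1 : A)).
have [g gs] := H_rep (etrans (mulrNN 1 1) (mulr1 (1 : A))).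
have [[fx _ _ _ _] _] := fs; have [[gx _ _ _ _] _] := gs.
have fz := rep_central_root fs; have gz := rep_central_root gs.
have X2 : 'X%:P + 'X%:P != 0 :> A.
  by rewrite -polyCD polyC_eq0 -mulr2n -mulr_natl mulf_neq0 ?polyX_eq0 //
     -polyC_natr polyC_eq0.
have z : mx2 0 0 0 0 = 0 :> 'M[A]_2 by rewrite -mx2_scalar raddf0.
move/(_ _ _ (ker_ideal f) (ker_ideal g)); case.
(* A product of an element of ker f and one of ker g lies in both kernels, hence is zero. *)
- move=> _ [s hs ->]; apply: big1_seq => p /hs[fp gp].
  by apply: (rep_faithful fs gs); rewrite rmorphM ?fp ?gp ?mul0r ?mulr0.
(* [central_root] acts as -x under [f] and as x under [g]; so adding x gives 0 under [f] but 2x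
   under [g]. *)
- move/(_ (central_root + hx)) => h.
  have /h zx0 : f (central_root + hx) = 0.
    by rewrite (rmorphD f) fz fx mx2_add -z; congr mx2; ring.
  have : g (central_root + hx) = 0 by rewrite zx0 rmorph0.
  rewrite (rmorphD g) gz gx mx2_add => /mx2_eq0[/eqP].
  by rewrite opprK mul1r (negbTE X2).
(* Subtracting x instead gives 0 under [g] but -2x under [f]. *)
- move/(_ (central_root - hx)) => h.
  have /h zx0 : g (central_root - hx) = 0.
    by rewrite (rmorphB g) gz gx mx2_opp mx2_add -z; congr mx2; ring.
  have : f (central_root - hx) = 0 by rewrite zx0 rmorph0.
  rewrite (rmorphB f) fz fx mx2_opp mx2_add => /mx2_eq0[/eqP].
  by rewrite mulN1r -opprD oppr_eq0 (negbTE X2).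
Qed.
End OddCharacteristic.
End Representations.

Theorem lemma5 (k : closedFieldType) (char0 : [pchar k] =i pred0) :
  semiprime_ring (H_gl11 k) /\ ~ prime_ring (H_gl11 k).
Proof.
(* As 2 is prime, its absence from [[pchar k]] says that 2 is nonzero in [k]. *)
have two_neq0 : 2%:R != 0 :> k by have := char0 2; rewrite !inE /= => ->.
by split; [exact: H_semiprime | exact: H_not_prime].
Qed.
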